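(* Let $G$ be an infinite 2-generated abelian group. Then $\Gamma^*(G)$ is connected. Moreover, if either $G$ is cyclic or the torsion subgroup of $G$ is non-trivial, then $\operatorname{diam}(\Gamma^*(G))=2$, while $\operatorname{diam}(\Gamma^*(\mathbb{Z}\times\mathbb{Z}))=\infty$.
   Context: A group is 2-generated if it can be generated by two elements (cyclic groups are included). For a group $G$, the generating graph $\Gamma(G)$ is the graph whose vertices are the elements of $G$, two distinct vertices being connected by an edge if and only if they generate $G$. $\Gamma^*(G)$ is the subgraph of $\Gamma(G)$ induced by all the vertices of $\Gamma(G)$ that are not isolated. The diameter $\operatorname{diam}$ of a connected graph is the supremum of the distances between pairs of its vertices; it is $\infty$ if these distances are unbounded. *)

(* Defs.v *)
From HB Require Import structures.
From mathcomp Require Import all_boot all_order all_algebra.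
From mathcomp Require Import boolp classical_sets functions cardinality.
From mathcomp Require Import reals constructive_ereal ereal.
Set Implicit Arguments.
Unset Strict Implicit.
Unset Printing Implicit Defensive.
Import Order.TTheory GRing.Theory Num.Theory.
Local Open Scope classical_set_scope.
Local Open Scope ring_scope.

Record sgraph := SGraph {
  vertex :> Type;
  adj : rel vertex;
  adj_sym : symmetric adj;
  adj_irr : irreflexive adj
}.

Section SimpleGraphs.
Variable D : sgraph.
Implicit Types x y : D.

Definition isolated x : Prop := forall y, ~~ adj x y.

Definition walk x y (n : nat) : Prop :=
  exists s : seq D, [/\ path (@adj D) x s, last x s = y & size s = n].

(* The null graph is not considered connected. *)
Definition connected_graph : Prop :=
  inhabited D /\ forall x y, exists n, walk x y n.

(* [+oo] when no walk joins [x] to [y]. *)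
Definition dist (R : realType) x y : \bar R :=
  ereal_inf [set n%:R%:E | n in walk x y].

Definition diam (R : realType) : \bar R :=
  ereal_sup [set dist R p.1 p.2 | p in [set: D * D]].

Section Induced.
Variable A : set D.

Definition induced_adj : rel A := fun u v => adj (val u) (val v).

Lemma induced_adj_sym : symmetric induced_adj.
Proof. by move=> u v; exact: adj_sym. Qed.

Lemma induced_adj_irr : irreflexive induced_adj.
Proof. by move=> u; exact: adj_irr. Qed.

Definition induced : sgraph := SGraph induced_adj_sym induced_adj_irr.
End Induced.

End SimpleGraphs.

Section GeneratingGraph.
Variable G : zmodType.
Implicit Types (x y : G) (X : set G).

Definition subgroup_generated X : set G :=
  smallest [set H : set G | zmod_closed [in H]] X.

Definition generates X : Prop := subgroup_generated X = [set: G].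

Definition two_generated : Prop := exists x y, generates [set x; y].

Definition cyclic_group : Prop := exists x, generates [set x].

Definition torsion_subgroup : set G :=
  [set x | exists2 n : nat, (0 < n)%N & x *+ n = 0].

Definition gen_adj : rel G := fun x y => `[< x <> y /\ generates [set x; y] >].

Lemma gen_adj_sym : symmetric gen_adj.
Proof.
by move=> x y; apply/asboolP/asboolP => -[xy gxy]; split;
  [exact/nesym | rewrite setUC | exact/nesym | rewrite setUC].
Qed.

Lemma gen_adj_irr : irreflexive gen_adj.
Proof. by move=> x; apply/asboolP => -[]. Qed.

Definition gen_graph : sgraph := SGraph gen_adj_sym gen_adj_irr.

Definition gen_graph_star : sgraph :=
  induced [set x : gen_graph | ~ isolated x].

End GeneratingGraph.

Arguments torsion_subgroup G : clear implicits.

(* Main.v *)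
Require Import Defs.
From HB Require Import structures.
From mathcomp Require Import all_boot all_order all_algebra.
From mathcomp Require Import boolp classical_sets functions cardinality.
From mathcomp Require Import reals constructive_ereal ereal.
From mathcomp Require Import zify ring.
Set Implicit Arguments.
Unset Strict Implicit.
Unset Printing Implicit Defensive.
Import Order.TTheory GRing.Theory Num.Theory.
Local Open Scope classical_set_scope.
Local Open Scope ring_scope.

(** An infinite abelian group generated by two elements has generators [e],
    [f] whose relations are exactly the multiples of [d f = 0], for one integer
    [d]: either it is free on [e, f] and [d = 0], or it is Z times a cyclic
    group of order [|d|] ([adapted_pair_exists]). In the coordinates given by
    [e] and [f], the elements [(x1, x2)] and [(y1, y2)] generate the group if
    and only if [x1] and [y1] are coprime and the determinant
    [x1 y2 - x2 y1] is a unit modulo [d] ([generates_det]). Everything else is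
    arithmetic on these two conditions.

    When [d] is nonzero, which is the case of a cyclic group and of a group with
    torsion, two non-isolated vertices both generate the group together with some
    [(c, t)], so their distance is at most 2 ([dist_le2]). For the
    determinants to be units it suffices to avoid, for each prime [p]
    dividing [d], at most two residues of [t] modulo [p] when [c] is fixed, and the
    Chinese remainder theorem assembles the local choices. Taking [c = 1] makes
    the coprimality of first coordinates automatic. It fails only when the two
    forbidden residues exhaust the integers modulo 2; both first coordinates are
    then odd, and [c = 2] works ([common_neighbour]). Distance 2 is attained by
    [2e + f] and its opposite, whose first coordinates are both even
    ([far_pair]).

    When [d = 0] the edges are the bases of the free group. Replacing [y]
    by [y - q x] keeps it a neighbour of [x], so the Euclidean algorithm on
    first coordinates leads from any vertex to [e] ([walk_to_e]). The diameter
    is infinite because the ends of an edge separate the graph: a vector with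
    coordinates of opposite strict signs in some basis is not adjacent to one
    with coordinates of the same strict sign. The images of the pair of
    quadrants [x1 x2 >= 0] under the powers of the matrix with rows [(2, 1)] and
    [(1, 1)] are nested cones, each in the interior of the previous one, and a
    step of a walk can leave at most one of them ([cone_step]). *)

(** * Avoiding residues modulo primes *)

Lemma Euclid_dvdzM (p : nat) (m n : int) : prime p ->
  (p %| m * n)%Z = (p %| m)%Z || (p %| n)%Z.
Proof. by move=> pp; rewrite !dvdzE abszM Euclid_dvdM. Qed.

Lemma coprimez_of_primes (m d : int) : d != 0 ->
  (forall p : nat, prime p -> (p %| d)%Z -> ~~ (p %| m)%Z) -> coprimez m d.
Proof.
move=> d0 H; rewrite /coprimez /gcdz; set g := gcdn _ _.
have g_gt0 : (0 < g)%N by rewrite gcdn_gt0 !absz_gt0 d0 orbT.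
have [g1|g1] := ltnP 1 g; last by rewrite (_ : g = 1%N) //; lia.
have pp := pdiv_prime g1; have pg := pdiv_dvd g.
have := H _ pp; rewrite !dvdzE (dvdn_trans pg (dvdn_gcdr _ _)).
by rewrite (dvdn_trans pg (dvdn_gcdl _ _)) => /(_ isT).
Qed.

Lemma coprimez_dvd (p : nat) (m n : int) : prime p -> coprimez m n ->
  (p %| m)%Z -> ~~ (p %| n)%Z.
Proof.
move=> pp mn pm; apply/negP => pn.
have: (p %| gcdz m n)%Z by rewrite dvdz_gcd pm.
by rewrite (eqP mn) dvdz1 absz_nat; case: p pp {pm pn} => [|[]].
Qed.

(** The Chinese remainder theorem for a condition depending on [t] modulo [p]
    for each prime [p <= m]. In the inductive step the modulus collecting the
    smaller primes is [m`!], which is coprime to the prime [m.+1] by Wilson's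
    theorem. *)
Lemma chinese_primes (good : nat -> int -> Prop) :
  (forall (p : nat) (t u : int), (p %| t - u)%Z -> good p t -> good p u) ->
  (forall p, prime p -> exists t, good p t) ->
  forall m, exists t, forall p, prime p -> (p <= m)%N -> good p t.
Proof.
move=> goodE ex_good; elim=> [|m [t tP]].
  by exists 0 => p /prime_gt0; case: p.
have [mp|mNp] := boolP (prime m.+1); last first.
  exists t => p pp; rewrite leq_eqVlt => /orP[/eqP pm|]; last exact: tP.
  by rewrite -pm pp in mNp.
have [u uP] := ex_good _ mp.
have co : coprimez m`!%:Z m.+1%:Z.
  rewrite /coprimez /gcdz !absz_nat eqz_nat -/(coprime _ _) coprime_sym.
  have [m0|m_gt0] := posnP m; first by rewrite m0.
  rewrite prime_coprime //; apply/negP => dm.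
  have := dvdn_addr 1 dm; rewrite addn1.
  have := Wilson (prime_gt1 mp); rewrite mp /= => /esym ->.
  by rewrite dvdn1; lia.
exists (zchinese m`! m.+1 t u) => p pp; rewrite leq_eqVlt => /orP[/eqP ->|pm].
  apply: goodE uP; rewrite -eqz_mod_dvd; apply/eqP/esym; exact: zchinese_modr.
apply: (goodE p t); last exact: tP.
apply: (@dvdz_trans m`!%:Z).
  by rewrite dvdzE !absz_nat dvdn_fact ?prime_gt0.
by rewrite -eqz_mod_dvd; apply/eqP/esym; exact: zchinese_modl.
Qed.

(** An affine form that does not vanish identically modulo [p] has at most one
    root modulo [p]. *)
Lemma affine_root_uniq (p : nat) (a b s t : int) : prime p ->
  ~~ ((p %| a)%Z && (p %| b)%Z) ->
  (p %| a * s + b)%Z -> (p %| a * t + b)%Z -> (p %| s - t)%Z.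
Proof.
move=> pp ab ps pt.
have := rpredB ps pt.
rewrite (_ : _ - _ = a * (s - t)); last by ring.
rewrite Euclid_dvdzM // => /orP[pa|//].
by move: ab ps; rewrite pa rpredDl ?dvdz_mulr //= => /negP.
Qed.

(** Each form excludes at most one of the residues 0, 1, 2, and these are
    distinct because [p > 2]. *)
Lemma affine_avoid (p : nat) (a b a' b' : int) : prime p -> (2 < p)%N ->
  ~~ ((p %| a)%Z && (p %| b)%Z) -> ~~ ((p %| a')%Z && (p %| b')%Z) ->
  exists t, ~~ (p %| a * t + b)%Z && ~~ (p %| a' * t + b')%Z.
Proof.
move=> pp p2 ab ab'; apply/not_existsP => H.
have {}H t : (p %| a * t + b)%Z || (p %| a' * t + b')%Z.
  by rewrite -[X in is_true X]negbK negb_or; apply/negP/H.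
have N1 : ~~ (p %| 0%:Z - 1%:Z)%Z.
  by rewrite dvdzE absz_nat /= gtnNdvd //; lia.
have N2 : ~~ (p %| 1%:Z - 2%:Z)%Z by rewrite dvdzE absz_nat /= gtnNdvd //; lia.
have N3 : ~~ (p %| 0%:Z - 2%:Z)%Z by rewrite dvdzE absz_nat /= gtnNdvd //; lia.
(* Two of the residues 0, 1, 2 cannot be roots of the same form. *)
have V c e (ce : ~~ ((p %| c)%Z && (p %| e)%Z)) s t (st : ~~ (p %| s - t)%Z) :
  (p %| c * s + e)%Z -> (p %| c * t + e)%Z -> False.
  by move=> h1 h2; move: st; rewrite (affine_root_uniq pp ce h1 h2).
have V01 := V _ _ ab _ _ N1; have V12 := V _ _ ab _ _ N2.
have V02 := V _ _ ab _ _ N3.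
have W01 := V _ _ ab' _ _ N1; have W12 := V _ _ ab' _ _ N2.
have W02 := V _ _ ab' _ _ N3.
case/orP: (H 0) => h0; case/orP: (H 1) => h1; case/orP: (H 2%:Z) => h2; auto.
Qed.

(** The first coordinate of the common neighbour of [(x1, x2)] and [(z1, z2)].
    The value 2 is needed when the two vectors reduce modulo 2 to [(1, 0)] and
    [(1, 1)], whose only common neighbour over the field with two elements is
    [(0, 1)]. *)
Definition pivot (x1 x2 z1 z2 : int) : int :=
  if [&& ~~ (2 %| x1)%Z, ~~ (2 %| z1)%Z & ~~ (2 %| x2 - z2)%Z] then 2 else 1.

Lemma parity_avoid (x1 x2 z1 z2 : int) :
  ~~ ((2 %| x1)%Z && (2 %| x2)%Z) -> ~~ ((2 %| z1)%Z && (2 %| z2)%Z) ->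
  exists t : int, let c := pivot x1 x2 z1 z2 in
    ~~ (2 %| x1 * t - x2 * c)%Z && ~~ (2 %| z1 * t - z2 * c)%Z.
Proof.
move=> x z; rewrite /= /pivot; case: ifP => h; first by exists 1; lia.
case: (boolP (2 %| x1)%Z) => hx1; case: (boolP (2 %| z1)%Z) => hz1.
- by exists 0; lia.
- case: (boolP (2 %| z2)%Z) => hz2; [exists 1 | exists 0]; lia.
- case: (boolP (2 %| x2)%Z) => hx2; [exists 1 | exists 0]; lia.
- case: (boolP (2 %| x2)%Z) => hx2; [exists 1 | exists 0]; lia.
Qed.

(** The hypotheses say that both vectors are nonzero modulo every prime divisor
    of [d]. With [c] fixed, each prime imposes a condition on [t] alone, and
    only the primes up to [|d|] matter. *)
Lemma common_neighbour (d x1 x2 z1 z2 : int) : d != 0 ->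
  (forall p : nat, prime p -> (p %| d)%Z -> ~~ ((p %| x1)%Z && (p %| x2)%Z)) ->
  (forall p : nat, prime p -> (p %| d)%Z -> ~~ ((p %| z1)%Z && (p %| z2)%Z)) ->
  exists c t : int, [/\ coprimez x1 c, coprimez z1 c,
    coprimez (x1 * t - x2 * c) d & coprimez (z1 * t - z2 * c) d].
Proof.
move=> d0 x z; set c := pivot x1 x2 z1 z2.
have c12 : c = 1 \/ [/\ c = 2, ~~ (2 %| x1)%Z & ~~ (2 %| z1)%Z].
  by rewrite /c /pivot; case: ifP => [/and3P[]|]; [right|left].
have coc (n : int) : (c = 2 -> ~~ (2 %| n)%Z) -> coprimez n c.
  case: c12 => [->|[-> _ _ /(_ erefl)]]; first by rewrite coprimezE coprimen1.
  by rewrite dvdzE coprimezE coprime_sym prime_coprime.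
pose good (p : nat) (t : int) := (p %| d)%Z ->
  ~~ (p %| x1 * t - x2 * c)%Z && ~~ (p %| z1 * t - z2 * c)%Z.
have goodE (p : nat) (t u : int) : (p %| t - u)%Z -> good p t -> good p u.
  move=> tu gt /gt.
  rewrite (_ : x1 * t - _ = x1 * (t - u) + (x1 * u - x2 * c)); last by ring.
  rewrite (_ : z1 * t - _ = z1 * (t - u) + (z1 * u - z2 * c)); last by ring.
  by rewrite (rpredDl _ (dvdz_mull x1 tu)) (rpredDl _ (dvdz_mull z1 tu)).
have ex_good (p : nat) : prime p -> exists t, good p t.
  move=> pp.
  have [pd|pNd] := boolP (p %| d)%Z; last by exists 0 => /(negP pNd).
  have [p2|p2] := ltnP 2 p.
    have pc : ~~ (p %| c)%Z.
      case: c12 => [->|[-> _ _]]; rewrite dvdzE absz_nat /= gtnNdvd //; lia.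
    have nd (y1 y2 : int) : ~~ ((p %| y1)%Z && (p %| y2)%Z) ->
        ~~ ((p %| y1)%Z && (p %| - (y2 * c))%Z).
      by rewrite rpredN Euclid_dvdzM // (negbTE pc) orbF.
    have [t tP] :=
      affine_avoid pp p2 (nd _ _ (x _ pp pd)) (nd _ _ (z _ pp pd)).
    by exists t.
  have {p2} p2 : p = 2 by have := prime_gt1 pp; lia.
  rewrite p2 in pp pd *.
  have [t tP] := parity_avoid (x _ pp pd) (z _ pp pd).
  by exists t.
have [t tP] := chinese_primes goodE ex_good `|d|.
have {}tP p : prime p -> (p %| d)%Z ->
    ~~ (p %| x1 * t - x2 * c)%Z && ~~ (p %| z1 * t - z2 * c)%Z.
  move=> pp pd; apply: tP => //.
  by rewrite dvdn_leq ?absz_gt0 // -(absz_nat p) -dvdzE.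
exists c, t; split.
- by apply: coc => c2; case: c12 => [|[]] //; rewrite c2.
- by apply: coc => c2; case: c12 => [|[]] //; rewrite c2.
- by apply: coprimez_of_primes => // p pp /(tP p pp)/andP[].
- by apply: coprimez_of_primes => // p pp /(tP p pp)/andP[].
Qed.

(** * Walks and distances *)

Section Walks.
Variable D : sgraph.
Implicit Types x y z : D.

Lemma walk_adj x y : adj x y -> walk x y 1.
Proof. by move=> xy; exists [:: y]; rewrite /= xy. Qed.

Lemma walk_cat x y z m n : walk x y m -> walk y z n -> walk x z (m + n).
Proof.
move=> [s [ps ls <-]] [t [pt lt <-]]; exists (s ++ t).
by rewrite cat_path ps ls last_cat ls size_cat.
Qed.

Lemma walk_rec x y n : walk x y n.+1 -> exists2 z, adj x z & walk z y n.
Proof. by move=> [[|z s] [//= /andP[xz zs] l [sn]]]; exists z => //; exists s. Qed.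

Lemma walk0 x y : walk x y 0 -> x = y.
Proof. by move=> [[|z s] []]. Qed.

Lemma walk_sym x y n : walk x y n -> walk y x n.
Proof.
elim: n x => [|n IH] x; first by move=> /walk0 ->; exists [::].
move=> /walk_rec[z xz /IH yz]; rewrite -addn1; apply: walk_cat yz _.
by apply: walk_adj; rewrite adj_sym.
Qed.

Lemma dist_le (R : realType) x y n : walk x y n -> (dist R x y <= n%:R%:E)%E.
Proof. by move=> w; apply: ereal_inf_lbound; exists n. Qed.

Lemma le_dist (R : realType) x y n :
  (forall m, walk x y m -> (n <= m)%N) -> (n%:R%:E <= dist R x y)%E.
Proof.
move=> w; apply/ereal_infP => _ [m xy <-].
by rewrite lee_fin ler_nat w.
Qed.

Lemma dist_le_diam (R : realType) x y : (dist R x y <= diam D R)%E.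
Proof. by apply: ereal_sup_ubound; exists (x, y). Qed.
End Walks.

(** * Coordinates in a two-generated abelian group *)

Section Coordinates.
Variable G : zmodType.
Implicit Types x y z e f : G.

Lemma generates2P x y :
  generates [set x; y] <-> forall z, exists m n : int, z = x *~ m + y *~ n.
Proof.
split=> [gxy z|gxy].
  (* The integral combinations form a subgroup containing [x] and [y]. *)
  have : subgroup_generated [set x; y] z by rewrite gxy.
  move=> /(_ [set z | exists m n : int, z = x *~ m + y *~ n]).
  apply; split; last first.
    move=> _ [->|->]; [exists 1, 0 | exists 0, 1].
      by rewrite mulr0z addr0.
    by rewrite mulr0z add0r.
  split=> [|u v].
    by rewrite inE; exists 0, 0; rewrite !mulr0z addr0.
  rewrite !inE => -[m [n ->]] [m' [n' ->]]; exists (m - m'), (n - n').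
  by rewrite !mulrzBr opprD addrACA.
apply/seteqP; split=> // z _ H [[H0 HB] xyH].
have HZ u (k : int) : u \in H -> u *~ k \in H.
  have HN v : v \in H -> - v \in H by move=> vH; rewrite -sub0r HB.
  have Hn v (j : nat) : v \in H -> v *+ j \in H.
    move=> vH; elim: j => [|j IH]; first by rewrite mulr0n.
    by rewrite mulrS -[v *+ j]opprK HB ?HN.
  by case: k => k uH; [exact: Hn | exact/HN/Hn].
have [m [n ->]] := gxy z; apply/set_mem.
rewrite -[y *~ n]opprK -mulrNz; apply: HB; apply: HZ; apply/mem_set/xyH.
  by left.
by right.
Qed.

(** The pair presents the group as Z x Z/dZ, with [d = 0] giving Z x Z and
    [d = 1] giving Z. *)
Definition adapted_pair e f (d : int) : Prop :=
  (forall z, exists m n : int, z = e *~ m + f *~ n) /\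
  forall m n : int, e *~ m + f *~ n = 0 <-> m = 0 /\ (d %| n)%Z.

Section AdaptedPair.
Variables (e f : G) (d : int).
Hypothesis ef : adapted_pair e f d.
Local Notation vec m n := (e *~ m + f *~ n).

Lemma adapted_eq (m n m' n' : int) :
  vec m n = vec m' n' <-> m = m' /\ (d %| n - n')%Z.
Proof.
have -> : (vec m n = vec m' n') <-> vec (m - m') (n - n') = 0.
  rewrite !mulrzBr addrACA -opprD; split=> [->|/eqP]; first by rewrite subrr.
  by rewrite subr_eq0 => /eqP.
by rewrite ef.2; split=> -[h ->]; split=> //; [exact: subr0_eq | rewrite h subrr].
Qed.

Lemma vec_comb (a b a' b' m n : int) :
  vec a b *~ m + vec a' b' *~ n = vec (a * m + a' * n) (b * m + b' * n).
Proof. by rewrite !mulrzDl -!mulrzA addrACA -!mulrzDr. Qed.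

(** Generation means that the matrix [X] with rows [(x1, x2)], [(y1, y2)] has a
    left inverse, exactly on the first column and modulo [d] on the second.
    Taking determinants gives one direction. Conversely, if [a x1 + b y1 = 1],
    the vector [a x + b y] equals [e] up to a multiple of [f], and
    [x1 y - y1 x] is the multiple of [f] by the determinant, from which [f] is
    recovered since the determinant is invertible modulo [d]. *)
Lemma generates_det (x1 x2 y1 y2 : int) :
  generates [set vec x1 x2; vec y1 y2] <->
  coprimez x1 y1 /\ coprimez (x1 * y2 - x2 * y1) d.
Proof.
rewrite generates2P; split=> [gen|[/coprimezP[[a b] /= ab]]].
  have [a [b]] := gen (vec 1 0); rewrite vec_comb adapted_eq => -[ab].
  have [c [k]] := gen (vec 0 1); rewrite vec_comb adapted_eq => -[ck].
  move=> /dvdzP[q hq] /dvdzP[r hr]; split.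
    by apply/coprimezP; exists (a, b); rewrite /= ab; ring.
  apply/coprimezP; exists (a * k - b * c, q); rewrite /=.
  have -> : q * d = 1 - (x2 * c + y2 * k) by rewrite hq; ring.
  transitivity ((x1 * a + y1 * b) * (x2 * c + y2 * k)
    - (x1 * c + y1 * k) * (x2 * a + y2 * b) + (1 - (x2 * c + y2 * k))).
    by ring.
  by rewrite -ab -ck; ring.
move=> /coprimezP[[u v] /= uv] z; have [m [n ->]] := ef.1 z.
(* Correct [m (a x + b y)] in the second coordinate by a multiple of
   [x1 y - y1 x], that is, of the determinant times [f]. *)
pose w := u * (n - (a * x2 + b * y2) * m).
exists (a * m - y1 * w), (b * m + x1 * w); rewrite vec_comb adapted_eq.
split.
  transitivity ((a * x1 + b * y1) * m); first by rewrite ab mul1r.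
  by ring.
apply/dvdzP; exists ((n - (a * x2 + b * y2) * m) * v); rewrite /w.
transitivity ((n - (a * x2 + b * y2) * m) * (1 - u * (x1 * y2 - x2 * y1))).
  by ring.
by rewrite -uv; ring.
Qed.

End AdaptedPair.
End Coordinates.

(** * Vertices of the generating graph *)

Section Vertices.
Variable G : zmodType.

Definition elt (v : gen_graph_star G) : G := sval v.

Lemma elt_inj : injective elt.
Proof. by move=> [u hu] [v hv]; rewrite /elt /= => uv; apply: eq_exist. Qed.

Lemma star_adjE (u v : gen_graph_star G) : adj u v = gen_adj (elt u) (elt v).
Proof. by []. Qed.

Lemma star_vertex (x y : G) : gen_adj x y ->
  exists v : gen_graph_star G, elt v = x.
Proof.
move=> xy; have hx : ~ Defs.isolated (x : gen_graph G).
  by move=> /(_ y); rewrite /adj /= xy.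
pose A := [set z : gen_graph G | ~ Defs.isolated z].
by exists (exist (fun z => z \in A) x (@mem_set _ A x hx)).
Qed.

Lemma star_neighbour (v : gen_graph_star G) : exists y, gen_adj (elt v) y.
Proof.
case: v => x hx; have := set_mem hx => /= /existsNP[y] /negP.
by rewrite negbK; exists y.
Qed.

End Vertices.

(** * The graph in adapted coordinates *)

Section AdaptedGraph.
Variables (G : zmodType) (e f : G) (d : int).
Hypothesis ef : adapted_pair e f d.
Local Notation vec m n := (e *~ m + f *~ n).

(** The side condition provides the distinctness of adjacent vertices: equal
    vectors have a determinant divisible by [d], which is a unit modulo [d] only
    when [|d| = 1]. *)
Lemma gen_adj_det (x1 x2 y1 y2 : int) : x1 <> y1 \/ `|d|%N != 1%N ->
  gen_adj (vec x1 x2) (vec y1 y2) <->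
  coprimez x1 y1 /\ coprimez (x1 * y2 - x2 * y1) d.
Proof.
move=> ne; rewrite -(generates_det ef); split=> [/asboolP[]//|gen].
apply/asboolP; split=> // /(adapted_eq ef)[xy /dvdzP[q hq]]; case: ne => // /eqP.
apply.
have [_] := (generates_det ef _ _ _ _).1 gen.
have -> : x1 * y2 - x2 * y1 = (- (q * x1)) * d.
  by rewrite -xy; transitivity (- (x2 - y2) * x1); [ring|rewrite hq; ring].
move=> /eqP co; apply/eqP; rewrite -dvdz1 -[X in (_ %| X)%Z]co.
by rewrite dvdz_gcd dvdzz dvdz_mull.
Qed.

Lemma star_e : exists v : gen_graph_star G, elt v = vec 1 0.
Proof.
apply: (@star_vertex _ _ (vec 0 1)).
by apply/gen_adj_det; [left | rewrite mulr1 mul0r subr0 !coprimezE !coprime1n].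
Qed.

(** A prime dividing [d] and both coordinates would divide the determinant with
    any neighbour. *)
Lemma nonisolated_primes (u : gen_graph_star G) (x1 x2 : int) (p : nat) :
  elt u = vec x1 x2 -> prime p -> (p %| d)%Z -> ~~ ((p %| x1)%Z && (p %| x2)%Z).
Proof.
move=> ux pp pd; have [y] := star_neighbour u.
have [y1 [y2 ->]] := ef.1 y; rewrite ux => /asboolP[_ /(generates_det ef)[_ co]].
apply/negP => /andP[p1 p2]; have := coprimez_dvd pp co.
by rewrite pd rpredB ?dvdz_mulr // => /(_ isT).
Qed.

(** The common neighbour may coincide with [u] or [v], since a generator of a
    cyclic group generates with itself; then [u] and [v] are themselves
    adjacent. *)
Lemma dist_le2 (u v : gen_graph_star G) : d != 0 ->
  exists2 n, (n <= 2)%N & walk u v n.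
Proof.
move=> d0; have [x1 [x2 ux]] := ef.1 (elt u); have [z1 [z2 vz]] := ef.1 (elt v).
have [] := @common_neighbour d x1 x2 z1 z2 d0.
- by move=> p; apply: nonisolated_primes ux.
- by move=> p; apply: nonisolated_primes vz.
move=> c [t [xc zc xd zd]].
have gu : generates [set elt u; vec c t] by rewrite ux; apply/(generates_det ef).
have gv : generates [set elt v; vec c t] by rewrite vz; apply/(generates_det ef).
have [->|uv] := pselect (u = v); first by exists 0; last by exists [::].
have {}uv : elt u <> elt v by move=> /elt_inj.
have [uc|uc] := pselect (elt u = vec c t).
  exists 1%N => //; apply/walk_adj; rewrite star_adjE; apply/asboolP.
  by split=> //; rewrite uc setUC.
have [vc|vc] := pselect (elt v = vec c t).
  exists 1%N => //; apply/walk_adj; rewrite star_adjE; apply/asboolP.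
  by split=> //; rewrite vc.
have cu : gen_adj (vec c t) (elt u).
  by apply/asboolP; rewrite setUC; split=> // /esym.
have [w wc] := star_vertex cu.
exists 2%N => //; apply: (@walk_cat _ u w v 1 1).
  by apply: walk_adj; rewrite star_adjE wc; apply/asboolP.
by apply: walk_sym; apply: walk_adj; rewrite star_adjE wc; apply/asboolP.
Qed.

(** The vertices are [2e + f] and its opposite: their first coordinates are
    both even, so together they do not generate, while both are adjacent to
    [e]. *)
Lemma far_pair : exists u v : gen_graph_star G,
  forall n, walk u v n -> (2 <= n)%N.
Proof.
have e1 (x1 x2 : int) : x1 <> 1 -> coprimez (x1 * 0 - x2 * 1) d ->
    gen_adj (vec x1 x2) (vec 1 0).
  move=> x1n co; apply/gen_adj_det; first by left.
  by rewrite coprimezE coprimen1.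
have [//||u hu] := star_vertex (e1 2 1 _ _).
  by rewrite coprimezE coprime1n.
have [//||v hv] := star_vertex (e1 (-2) (-1) _ _).
  by rewrite coprimezE coprime1n.
exists u, v => -[/walk0 uv|[|//]].
  by have := hv; rewrite -uv hu => /(adapted_eq ef)[].
move=> /walk_rec[w + /walk0 wv]; rewrite wv star_adjE hu hv => /asboolP[_].
by move=> /(generates_det ef)[].
Qed.

Lemma diam2 (R : realType) : d != 0 -> diam (gen_graph_star G) R = 2%:E.
Proof.
move=> d0; apply/eqP; rewrite eq_le; apply/andP; split.
  apply/ereal_supP => _ [[u v] _ <-] /=.
  have [n n2 w] := dist_le2 u v d0; apply: le_trans (dist_le R w) _.
  by rewrite lee_fin (ler_nat R n 2).
have [u [v uv]] := far_pair.
by apply: le_trans (dist_le_diam R u v); apply: le_dist.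
Qed.

(** Euclid's algorithm: by induction on the absolute value of the first
    coordinate, a neighbour [y] of [x] can be replaced by the neighbour
    [y - q x], whose first coordinate is the remainder of [y1] modulo [x1]. *)
Lemma walk_to_e (E : gen_graph_star G) : d = 0 -> elt E = vec 1 0 ->
  forall u, exists n, walk u E n.
Proof.
move=> d0 hE; have d1 : `|d|%N != 1%N by rewrite d0.
suff H n (u : gen_graph_star G) (x1 x2 : int) :
    elt u = vec x1 x2 -> (`|x1| <= n)%N -> exists n, walk u E n.
  by move=> u; have [x1 [x2 ux]] := ef.1 (elt u); apply: (H `|x1|%N _ _ _ ux).
elim: n u x1 x2 => [|n IH] u x1 x2 ux.
  (* Here [elt u = x2 f], and having a neighbour forces [x2] to be 1 or -1. *)
  move=> x10; have {}x10 : x1 = 0 by lia.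
  have [y] := star_neighbour u; have [y1 [y2 ->]] := ef.1 y.
  rewrite ux x10 => /gen_adj_det[|_]; first by right.
  rewrite mul0r sub0r d0 coprimezE absz0 /coprime gcdn0 abszN abszM => /eqP xy.
  exists 1%N; apply: walk_adj; rewrite star_adjE ux hE x10; apply/gen_adj_det.
    by right.
  split=> //; rewrite d0 mul0r mulr1 sub0r coprimezE abszN absz0 /coprime gcdn0.
  by move: xy => /eqP; rewrite muln_eq1 => /andP[].
move=> x1n; have [x10|x10] := eqVneq x1 0; first by apply: IH ux _; lia.
have [y] := star_neighbour u; have [y1 [y2 ->]] := ef.1 y.
rewrite ux => /gen_adj_det[|_ co]; first by right.
pose q := (y1 %/ x1)%Z; pose w1 := (y1 %% x1)%Z.
have w1E : w1 = y1 - q * x1.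
  by apply/eqP; rewrite eq_sym subr_eq addrC; apply/eqP/divz_eq.
have uw : gen_adj (vec x1 x2) (vec w1 (y2 - q * x2)).
  apply/gen_adj_det; first by right.
  have -> : x1 * (y2 - q * x2) - x2 * w1 = x1 * y2 - x2 * y1.
    by rewrite w1E; ring.
  split=> //; move: co => /coprimezP[[a b] /= ab]; apply/coprimezP.
  have b0 : b * d = 0 by rewrite d0 mulr0.
  exists (a * (y2 - q * x2), - (a * x2)) => /=.
  by rewrite -ab b0 w1E; ring.
have [w ww] : exists w : gen_graph_star G, elt w = vec w1 (y2 - q * x2).
  by apply: (@star_vertex _ _ (vec x1 x2)); rewrite gen_adj_sym.
have [|k wk] := IH w _ _ ww.
  have := modz_ge0 y1 x10; have := ltz_mod y1 x10; rewrite -/w1; lia.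
exists (1 + k)%N; apply: walk_cat wk; apply: walk_adj.
by rewrite star_adjE ux ww.
Qed.

Lemma connected_star : connected_graph (gen_graph_star G).
Proof.
have [E hE] := star_e; split; first by exists.
move=> u v; have [d0|d0] := eqVneq d 0.
  have [m um] := walk_to_e d0 hE u; have [n vn] := walk_to_e d0 hE v.
  by exists (m + n)%N; apply: walk_cat um _; apply: walk_sym.
by have [n _ uv] := dist_le2 u v d0; exists n.
Qed.

Lemma adapted0_not_cyclic : d = 0 -> ~ cyclic_group G.
Proof.
move=> d0 [x]; rewrite -(setUid [set x]) generates2P => gx.
have [x1 [x2 hx]] := ef.1 x.
have : generates [set x; x] by apply/generates2P.
by rewrite hx => /(generates_det ef)[_]; rewrite d0 mulrC subrr.
Qed.

Lemma adapted0_torsion_free : d = 0 -> torsion_subgroup G = [set 0].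
Proof.
move=> d0; apply/seteqP; split=> [x [n n_gt0]|x ->]; last by exists 1%N.
have [x1 [x2 ->]] := ef.1 x.
rewrite -[_ *+ n]/(_ *~ n%:Z) mulrzDl -!mulrzA ef.2 d0 dvd0z.
move=> [/eqP + +]; rewrite !mulf_eq0 !eqz_nat (gtn_eqF n_gt0) !orbF.
by move=> /eqP -> /eqP ->; rewrite !mulr0z addr0.
Qed.
End AdaptedGraph.

(** * Structure of infinite two-generated abelian groups *)

Section Structure.
Variable G : zmodType.
Implicit Types e f : G.

Lemma finite_of_torsion_pair e f (k l : int) :
  (forall z, exists m n : int, z = e *~ m + f *~ n) ->
  k != 0 -> l != 0 -> e *~ k = 0 -> f *~ l = 0 -> finite_set [set: G].
Proof.
move=> gen k0 l0 ek fl.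
have red (g : G) (j m : int) : j != 0 -> g *~ j = 0 ->
    exists2 i : nat, (i < `|j|)%N & g *~ m = g *~ i.
  move=> j0 gj; exists `|(m %% j)%Z|%N.
    by have := modz_ge0 m j0; have := ltz_mod m j0; lia.
  rewrite gez0_abs ?modz_ge0 // {1}(divz_eq m j) mulrzDr mulrC mulrzA gj.
  by rewrite mul0rz add0r.
apply: (@sub_finite_set _ _
  [set e *~ i%:Z + f *~ j%:Z | i in `I_`|k| & j in `I_`|l|]); last first.
  by apply: finite_image2; exact: finite_II.
move=> z _; have [m [n ->]] := gen z.
have [i ik ->] := red _ _ m k0 ek; have [j jl ->] := red _ _ n l0 fl.
by exists i => //; exists j.
Qed.

Lemma torsion_order f : (exists2 k : int, k != 0 & f *~ k = 0) ->
  exists2 d : int, d != 0 & forall n : int, f *~ n = 0 <-> (d %| n)%Z.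
Proof.
move=> [k k0 fk]; pose P (n : nat) := (0 < n)%N && (f *~ n%:Z == 0).
have exP : exists n, P n.
  exists `|k|%N; rewrite /P absz_gt0 k0 /=.
  by case: k {k0} fk => n /eqP; rewrite ?NegzE ?mulrNz ?oppr_eq0 ?abszN.
case: (ex_minnP exP) => d /andP[d_gt0 /eqP fd] dmin.
have d0 : d%:Z != 0 by lia.
exists d%:Z => // n; split=> [fn|/dvdzP[q ->]]; last first.
  by rewrite mulrC mulrzA fd mul0rz.
have fr : f *~ (n %% d)%Z = 0.
  move: fn; rewrite {1}(divz_eq n d) mulrzDr mulrC mulrzA fd.
  by rewrite mul0rz add0r.
have r_ge0 := modz_ge0 n d0; have r_lt := ltz_mod n d0.
apply/dvdz_mod0P/eqP/negPn/negP => r0.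
have := dmin `|(n %% d)%Z|%N; rewrite /P absz_gt0 r0 gez0_abs // fr eqxx.
by move=> /(_ isT); lia.
Qed.

(** If the generators [a], [b] satisfy a nontrivial relation [m a + n b = 0],
    let [g = gcd(m, n)], [m = p g], [n = q g] and [u p + v q = 1]. The change of
    basis [e = - v a + u b], [f = p a + q b] has determinant -1, and [g f = 0].
    As the group is infinite, [e] has infinite order even modulo [f], and [d] is
    the order of [f]. *)
Lemma adapted_pair_exists : infinite_set [set: G] -> two_generated G ->
  exists e f (d : int), adapted_pair e f d.
Proof.
move=> inf [a [b /generates2P gen]].
have [free|] :=
  pselect (forall m n : int, a *~ m + b *~ n = 0 -> m = 0 /\ n = 0).
  exists a, b, 0; split=> // m n; split=> [/free[-> ->]//|[->]].
  by rewrite dvd0z => /eqP ->; rewrite !mulr0z addr0.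
move=> /existsNP[m /existsNP[n /not_implyP[mn0 nz]]].
pose g := gcdz m n.
have g0 : g != 0.
  by rewrite gcdz_eq0; apply/negP => /andP[/eqP m0 /eqP n0]; exact: nz.
have [p mp] := dvdzP (dvdz_gcdl m n); have [q nq] := dvdzP (dvdz_gcdr m n).
have [u [v uv]] := Bezoutz m n.
have {}uv : u * p + v * q = 1.
  apply: (mulIf g0); transitivity (u * (p * g) + v * (q * g)); first by ring.
  by rewrite -mp -nq mul1r.
pose f := a *~ p + b *~ q; pose e := a *~ - v + b *~ u.
have fg : f *~ g = 0 by rewrite mulrzDl -!mulrzA -mp -nq.
have comb (x1 x2 : int) : e *~ x1 + f *~ x2
    = a *~ (- v * x1 + p * x2) + b *~ (u * x1 + q * x2) by rewrite vec_comb.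
have gen' z : exists x1 x2 : int, z = e *~ x1 + f *~ x2.
  have [x1 [x2 ->]] := gen z; exists (- q * x1 + p * x2), (u * x1 + v * x2).
  rewrite comb; congr (a *~ _ + b *~ _).
    transitivity ((u * p + v * q) * x1); [by rewrite uv mul1r | ring].
  transitivity ((u * p + v * q) * x2); [by rewrite uv mul1r | ring].
have [d d0 dP] : exists2 d : int, d != 0 & forall n, f *~ n = 0 <-> (d %| n)%Z.
  by apply: torsion_order; exists g.
exists e, f, d; split=> // x1 x2; split=> [x0|[-> /dP ->]]; last first.
  by rewrite mulr0z addr0.
have x10 : x1 = 0.
  apply/eqP/negPn/negP => x1n; apply: inf.
  apply: (finite_of_torsion_pair gen' (k := x1 * g) _ g0 _ fg).
    by rewrite mulf_neq0.
  have : (e *~ x1 + f *~ x2) *~ g = 0 by rewrite x0 mul0rz.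
  by rewrite mulrzDl -!mulrzA [x2 * g]mulrC [f *~ (_ * _)]mulrzA fg mul0rz addr0.
by split=> //; apply/dP; move: x0; rewrite x10 mulr0z add0r.
Qed.
End Structure.

(** * Nested cones and the diameter of the graph of Z x Z *)

(** [cone n] is the image of the pair of closed quadrants [x1 x2 >= 0] under the
    [n]-th power of the matrix with rows [(2, 1)] and [(1, 1)]; the recursive
    call applies the inverse matrix. *)
Fixpoint cone (n : nat) (x1 x2 : int) : bool :=
  if n is n'.+1 then cone n' (x1 - x2) (2 * x2 - x1) else 0 <= x1 * x2.

(** Shows that [x1 x2] is positive on the nonzero vectors of [cone 1], where
    [(x1 - x2) * (2 x2 - x1) >= 0]: the next cone lies in the interior of the
    quadrants. *)
Lemma cone_form (x1 x2 : int) : x1 * x2 =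
  2 * (x1 - x2) ^+ 2 + 3 * ((x1 - x2) * (2 * x2 - x1)) + (2 * x2 - x1) ^+ 2.
Proof. by ring. Qed.

(** By invariance of the determinant it suffices to treat [n = 0]. There
    [x1 x2 > 0], and [y1 y2 < 0] would make the square of the determinant
    [(x1 y2 + x2 y1)^2 - 4 x1 x2 y1 y2] at least 4. *)
Lemma cone_step n (x1 x2 y1 y2 : int) :
  `|(x1 * y2 - x2 * y1)%R|%N = 1%N -> cone n.+1 x1 x2 -> cone n y1 y2.
Proof.
elim: n x1 x2 y1 y2 => [|n IH] x1 x2 y1 y2 det1; last first.
  apply: IH; rewrite -[RHS]det1; congr (`|_|%N); ring.
rewrite /= => xx; rewrite leNgt; apply/negP => yy.
have x_gt0 : 0 < x1 * x2.
  rewrite cone_form; have [s0|s0] := eqVneq (x1 - x2) 0; last first.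
    rewrite ltr_wpDr ?sqr_ge0 // ltr_wpDr ?(mulr_ge0 _ xx) //.
    by rewrite mulr_gt0 // exprn_even_gt0.
  rewrite s0 expr0n mul0r !mulr0 !add0r exprn_even_gt0 //=.
  apply/eqP => t0; have [x10 x20] : x1 = 0 /\ x2 = 0 by move: s0 t0; clear; lia.
  by move: det1; rewrite x10 x20 !mul0r.
have det2 : (x1 * y2 - x2 * y1) ^+ 2 = 1.
  move: (x1 * y2 - x2 * y1) det1 => D D1.
  by have [->|->] : D = 1 \/ D = -1 by move: D1; clear; lia.
have := sqr_ge0 (x1 * y2 + x2 * y1).
have -> : (x1 * y2 + x2 * y1) ^+ 2
    = (x1 * y2 - x2 * y1) ^+ 2 + 4 * ((x1 * x2) * (y1 * y2)) by ring.
have : (x1 * x2) * (y1 * y2) < 0 by rewrite pmulr_rlt0.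
by rewrite det2; move: (_ * (y1 * y2)) => w; clear; lia.
Qed.

Lemma cone_mono n (x1 x2 : int) : cone n.+1 x1 x2 -> cone n x1 x2.
Proof.
elim: n x1 x2 => [|n IH] x1 x2; last exact: IH.
move=> /= xx; rewrite cone_form.
by rewrite !addr_ge0 ?(mulr_ge0 _ xx) ?(mulr_ge0 _ (sqr_ge0 _)) ?sqr_ge0.
Qed.

Lemma cone_le m n (x1 x2 : int) : (m <= n)%N -> cone n x1 x2 -> cone m x1 x2.
Proof.
elim: n => [|n IH]; first by rewrite leqn0 => /eqP ->.
by rewrite leq_eqVlt => /orP[/eqP ->//|/IH mn /cone_mono].
Qed.

(** The images of the standard basis under the powers of the matrix; the second
    vector serves to show that the first is not isolated. *)
Lemma cone_edge n : exists x1 x2 y1 y2 : int,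
  x1 * y2 - x2 * y1 = 1 /\ cone n x1 x2.
Proof.
elim: n => [|n [x1 [x2 [y1 [y2 [det1 xn]]]]]]; first by exists 1, 0, 0, 1.
exists (2 * x1 + x2), (x1 + x2), (2 * y1 + y2), (y1 + y2); split.
  by rewrite -[RHS]det1; ring.
rewrite /=.
have -> : 2 * x1 + x2 - (x1 + x2) = x1 by ring.
by have -> : 2 * (x1 + x2) - (2 * x1 + x2) = x2 by ring.
Qed.

Lemma vec_Z2 (m n : int) : ((1, 0) : int * int) *~ m + (0, 1) *~ n = (m, n).
Proof.
have pE (x y k : int) : ((x, y) : int * int) *~ k = (x *~ k, y *~ k).
  rewrite [LHS]surjective_pairing; congr pair.
    exact: (raddfMz (@fst int int)).
  exact: (raddfMz (@snd int int)).
by rewrite !pE !mul0rz !intz; congr pair; rewrite /= ?addr0 ?add0r.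
Qed.

Lemma adapted_pair_Z2 : @adapted_pair (int * int)%type (1, 0) (0, 1) 0.
Proof.
split=> [[m n]|m n]; first by exists m, n; rewrite vec_Z2.
by rewrite vec_Z2 dvd0z; split=> [[-> ->]//|[-> /eqP ->]//].
Qed.

(** The vertex [(1, - 1)] lies outside [cone 0], so a walk to it from a vertex
    of [cone n] has more than [n] steps. *)
Lemma diam_Z2 (R : realType) : diam (gen_graph_star (int * int)%type) R = +oo%E.
Proof.
have ef := adapted_pair_Z2.
have star (x1 x2 y1 y2 : int) : x1 * y2 - x2 * y1 = 1 ->
    exists v : gen_graph_star (int * int)%type, elt v = (x1, x2).
  move=> det1; rewrite -(vec_Z2 x1 x2).
  apply: (@star_vertex _ _ ((1, 0) *~ y1 + (0, 1) *~ y2)).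
  apply/(gen_adj_det ef); first by right.
  rewrite det1 coprimezE; split=> //; apply/coprimezP.
  by exists (y2, - x2); rewrite -det1 /=; ring.
have walk_cone m k (u v : gen_graph_star (int * int)%type) : walk u v m ->
    cone (m + k) (elt u).1 (elt u).2 -> cone k (elt v).1 (elt v).2.
  elim: m u => [|m IH] u; first by move=> /walk0 ->.
  move=> /walk_rec[w uw wv] cu; apply: IH wv _; apply: cone_step cu.
  move: uw; rewrite star_adjE; case: (elt u) (elt w) => x1 x2 [y1 y2] /=.
  rewrite -(vec_Z2 x1 x2) -(vec_Z2 y1 y2) => /(gen_adj_det ef)[|_]; first by right.
  by rewrite coprimezE /coprime gcdn0 => /eqP.
have [v hv] := star 1 (- 1) 0 1 erefl.
apply/eqyP => A A_gt0.
pose n := (Num.truncn A).+1.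
have [x1 [x2 [y1 [y2 [det1 xn]]]]] := cone_edge n.
have [u hu] := star _ _ _ _ det1.
apply: le_trans (dist_le_diam R u v).
apply: (@le_trans _ _ n%:R%:E); first by rewrite lee_fin ltW // truncnS_gt.
apply: le_dist => m uv; rewrite leqNgt; apply/negP => mn.
have := walk_cone m (n - m)%N u v uv.
rewrite subnKC ?(ltnW mn) // hu hv => /(_ xn).
by move=> /(cone_le (leq0n _)).
Qed.

Unset Implicit Arguments.

Theorem theorem1 (R : realType) :
  (forall G : zmodType,
     infinite_set [set: G] -> two_generated G ->
     connected_graph (gen_graph_star G) /\
     (cyclic_group G \/ torsion_subgroup G <> [set 0] ->
      diam (gen_graph_star G) R = 2%:E)) /\
  diam (gen_graph_star (int * int)%type) R = +oo%E.
Proof.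
split; last exact: diam_Z2.
move=> G inf gen; have [e [f [d ef]]] := adapted_pair_exists inf gen.
split; first exact: connected_star ef.
move=> cyc_tor; apply: (diam2 ef); apply/eqP => d0.
case: cyc_tor; first exact: (adapted0_not_cyclic ef d0).
by apply; exact: (adapted0_torsion_free ef d0).
Qed.
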